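(* Let $M\subseteq\{\Box,\Diamond,\wedge,\vee,\overline{\cdot},\top,\bot,\veebar\}$ with $\Box\notin M$ or $\Diamond\notin M$. Then $\mathrm{MDL\text{-}SAT}(M\cup\{\mathrm{dep}\})\le^p_m\mathrm{MDL\text{-}SAT}(M\cup\{\top,\bot\})$, where $\le^p_m$ denotes polynomial-time many-one reducibility.
   Context: Modal dependence logic (MDL). Fix a set $AP$ of atomic propositions. MDL formulas are generated by $\varphi ::= \top \mid \bot \mid p \mid \overline{p} \mid \mathrm{dep}(p_1,\dots,p_{n-1};p_n) \mid \overline{\mathrm{dep}(p_1,\dots,p_{n-1};p_n)} \mid \varphi\wedge\varphi \mid \varphi\vee\varphi \mid \varphi\veebar\varphi \mid \Box\varphi \mid \Diamond\varphi$, where $p,p_i\in AP$ and $n\ge 1$. Here $\overline{\cdot}$ is negation (applied only to atomic propositions and dependence atoms), $\mathrm{dep}(p_1,\dots,p_{n-1};p_n)$ is a dependence atom, $\vee$ is dependence disjunction and $\veebar$ is classical disjunction. A frame is $W=(S,R,\pi)$ with $S$ a nonempty set of worlds, $R\subseteq S\times S$, and $\pi:S\to 2^{AP}$. For $T\subseteq S$, satisfaction $W,T\models\varphi$ is defined by: $W,T\models\top$ always; $W,T\models\bot$ iff $T=\emptyset$; $W,T\models p$ iff $p\in\pi(s)$ for all $s\in T$; $W,T\models\overline{p}$ iff $p\notin\pi(s)$ for all $s\in T$; $W,T\models \mathrm{dep}(p_1,\dots,p_{n-1};p_n)$ iff for all $s_1,s_2\in T$ with $\pi(s_1)\cap\{p_1,\dots,p_{n-1}\}=\pi(s_2)\cap\{p_1,\dots,p_{n-1}\}$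 we have $p_n\in\pi(s_1)\Leftrightarrow p_n\in\pi(s_2)$; $W,T\models\overline{\mathrm{dep}(\dots)}$ iff $T=\emptyset$; $W,T\models\varphi\wedge\psi$ iff both hold; $W,T\models\varphi\vee\psi$ iff there are $T_1,T_2$ with $T=T_1\cup T_2$, $W,T_1\models\varphi$ and $W,T_2\models\psi$; $W,T\models\varphi\veebar\psi$ iff $W,T\models\varphi$ or $W,T\models\psi$; $W,T\models\Box\varphi$ iff $W,\{s'\mid \exists s\in T,(s,s')\in R\}\models\varphi$; $W,T\models\Diamond\varphi$ iff there is $T'\subseteq S$ with $W,T'\models\varphi$ such that every $s\in T$ has some $s'\in T'$ with $(s,s')\in R$. For a set $M$ of operators from $\{\Box,\Diamond,\wedge,\vee,\overline{\cdot},\top,\bot,\mathrm{dep},\veebar\}$, $\mathrm{MDL}[M]$ is the set of MDL formulas built from atomic propositions using only operators and constants from $M$ (a negated dependence atom uses both $\overline{\cdot}$ and $\mathrm{dep}$). $\mathrm{MDL\text{-}SAT}(M)$ is the problem: given $\varphi\in\mathrm{MDL}[M]$, decide whether there exist a frame $W$ and a nonempty team $T$ with $W,T\models\varphi$. *)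

(* Defs.v *)
From HB Require Import structures.
From mathcomp Require Import all_boot all_algebra.
From mathcomp Require Import boolp classical_sets.

Set Implicit Arguments.
Unset Strict Implicit.
Unset Printing Implicit Defensive.

Local Open Scope classical_set_scope.

(* Instances must be written over a finite alphabet, so the countably infinite
   set of atomic propositions is taken to be the set of binary words, each
   serving as its own name. *)
Definition AP : eqType := seq bool.

(* [Dep ps q] is dep(p_1, ..., p_{n-1}; p_n) with [ps] listing the p_i, i < n,
   and q = p_n; [ps] may be empty (n = 1). *)
Inductive formula : Type :=
| Top
| Bot
| Atom (p : AP)
| NegAtom (p : AP)
| Dep (ps : seq AP) (q : AP)
| NegDep (ps : seq AP) (q : AP)
| And (phi psi : formula)
| Or (phi psi : formula)      (* dependence disjunction *)
| COr (phi psi : formula)     (* classical disjunction *)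
| Box (phi : formula)
| Diamond (phi : formula).

Record frame := Frame {
  world :> Type;
  world_nonempty : [set: world] !=set0;
  rel_of : world -> world -> Prop;
  val_of : world -> set AP
}.

Fixpoint sat (W : frame) (T : set W) (phi : formula) : Prop :=
  match phi with
  | Top => True
  | Bot => T = set0
  | Atom p => forall s, T s -> val_of s p
  | NegAtom p => forall s, T s -> ~ val_of s p
  | Dep ps q => forall s1 s2, T s1 -> T s2 ->
      val_of s1 `&` [set` ps] = val_of s2 `&` [set` ps] ->
      (val_of s1 q <-> val_of s2 q)
  | NegDep _ _ => T = set0
  | And phi psi => sat T phi /\ sat T psi
  | Or phi psi =>
      exists T1 T2 : set W, [/\ T = T1 `|` T2, sat T1 phi & sat T2 psi]
  | COr phi psi => sat T phi \/ sat T psi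
  | Box phi => sat [set s' | exists2 s, T s & rel_of s s'] phi
  | Diamond phi => exists2 T' : set W, sat T' phi &
      forall s, T s -> exists2 s', T' s' & rel_of s s'
  end.

Definition satisfiable (phi : formula) : Prop :=
  exists (W : frame) (T : set W), T !=set0 /\ sat T phi.

Inductive operator : Type :=
| OBox | ODiamond | OAnd | OOr | ONeg | OTop | OBot | ODep | OCOr.

Fixpoint operators (phi : formula) : set operator :=
  match phi with
  | Top => [set OTop]
  | Bot => [set OBot]
  | Atom _ => set0
  | NegAtom _ => [set ONeg]
  | Dep _ _ => [set ODep]
  | NegDep _ _ => [set ONeg; ODep]
  | And phi psi => OAnd |` (operators phi `|` operators psi)
  | Or phi psi => OOr |` (operators phi `|` operators psi)
  | COr phi psi => OCOr |` (operators phi `|` operators psi)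
  | Box phi => OBox |` operators phi
  | Diamond phi => ODiamond |` operators phi
  end.

Definition MDL (M : set operator) : set formula :=
  [set phi | operators phi `<=` M].

(* [SAtom] announces the name of an atomic proposition, spelled with [SBit]s;
   [SSemi] is the semicolon of dependence atoms. *)
Inductive symbol : Type :=
| SBox | SDiamond | SAnd | SOr | SNeg | STop | SBot | SDep | SCOr
| SAtom | SSemi | SBit of bool.

Definition symbols : seq symbol :=
  [:: SBox; SDiamond; SAnd; SOr; SNeg; STop; SBot; SDep; SCOr;
      SAtom; SSemi; SBit false; SBit true].

Definition symbol_code (a : symbol) : nat :=
  match a with
  | SBox => 0 | SDiamond => 1 | SAnd => 2 | SOr => 3 | SNeg => 4 | STop => 5
  | SBot => 6 | SDep => 7 | SCOr => 8 | SAtom => 9 | SSemi => 10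
  | SBit b => 11 + b
  end.

Lemma symbol_codeK : pcancel symbol_code (onth symbols).
Proof. by do ![case]. Qed.

HB.instance Definition _ := Countable.copy symbol (pcan_type symbol_codeK).

Lemma symbols_enumP : Finite.axiom symbols.
Proof. by do ![case]. Qed.

HB.instance Definition _ := isFinite.Build symbol symbols_enumP.

Definition encode_atom (p : AP) : seq symbol := SAtom :: map SBit p.

Definition encode_dep (ps : seq AP) (q : AP) : seq symbol :=
  SDep :: flatten (map encode_atom ps) ++ SSemi :: encode_atom q.

(* Prefix (Polish) notation, hence no parentheses. *)
Fixpoint encode (phi : formula) : seq symbol :=
  match phi with
  | Top => [:: STop]
  | Bot => [:: SBot]
  | Atom p => encode_atom p
  | NegAtom p => SNeg :: encode_atom p
  | Dep ps q => encode_dep ps q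
  | NegDep ps q => SNeg :: encode_dep ps q
  | And phi psi => SAnd :: encode phi ++ encode psi
  | Or phi psi => SOr :: encode phi ++ encode psi
  | COr phi psi => SCOr :: encode phi ++ encode psi
  | Box phi => SBox :: encode phi
  | Diamond phi => SDiamond :: encode phi
  end.

Definition MDL_SAT (M : set operator) : set (seq symbol) :=
  [set w | exists phi, [/\ w = encode phi, MDL M phi & satisfiable phi]].

Inductive move : Type := MoveLeft | Stay | MoveRight.

(* A two-way infinite tape, blank ([None]) except for finitely many cells:
   the head scans [scanned]; [to_left] and [to_right] list the cells on its
   left and right, nearest first, followed by blanks forever. *)
Record tape (A : Type) := Tape {
  to_left : seq (option A);
  scanned : option A;
  to_right : seq (option A)
}.

Definition blank_tape (A : Type) : tape A := Tape [::] None [::].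

Definition write (A : Type) (a : option A) (t : tape A) : tape A :=
  Tape (to_left t) a (to_right t).

Definition shift (A : Type) (m : move) (t : tape A) : tape A :=
  let: Tape l a r := t in
  match m with
  | MoveLeft => Tape (behead l) (head None l) (a :: r)
  | Stay => t
  | MoveRight => Tape (a :: l) (head None r) (behead r)
  end.

Definition word_tape (A : Type) (w : seq A) : tape A :=
  let cells := map Some w in Tape [::] (head None cells) (behead cells).

Definition tape_cells (A : Type) (t : tape A) : seq (option A) :=
  rev (to_left t) ++ scanned t :: to_right t.

(* The position of the head is irrelevant. *)
Definition holds_word (A : Type) (t : tape A) (w : seq A) : Prop :=
  exists m n, tape_cells t = nseq m None ++ map Some w ++ nseq n None.

(* Deterministic multi-tape Turing machines over the alphabet [Sigma], with
   additional work symbols in [tm_work]. Tape [ord0] is the input tape and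
   tape [ord_max] the output tape; both are readable and writable, and they
   coincide if there is a single tape. *)
Record machine (Sigma : finType) := Machine {
  tm_state : finType;
  tm_work : finType;
  tm_extra : nat;
  tm_start : tm_state;
  tm_halt : pred tm_state;
  tm_next : tm_state -> {ffun 'I_tm_extra.+1 -> option (Sigma + tm_work)} ->
    tm_state * {ffun 'I_tm_extra.+1 -> option (Sigma + tm_work) * move}
}.

Section Run.

Variables (Sigma : finType) (X : machine Sigma).

Definition tape_symbol : Type := (Sigma + tm_work X)%type.

Definition config : Type :=
  (tm_state X * ('I_(tm_extra X).+1 -> tape tape_symbol))%type.

Definition lift_word (w : seq Sigma) : seq tape_symbol := map inl w.

Definition initial (w : seq Sigma) : config :=
  (tm_start X,
   fun i => if i == ord0 then word_tape (lift_word w) else blank_tape _).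

(* A halted configuration is left unchanged. *)
Definition step (c : config) : config :=
  let: (q, ts) := c in
  if tm_halt q then c else
  let: (q', act) := tm_next q [ffun i => scanned (ts i)] in
  (q', fun i => shift (act i).2 (write (act i).1 (ts i))).

Definition halts_with (n : nat) (w v : seq Sigma) : Prop :=
  let c := iter n step (initial w) in
  tm_halt c.1 /\ holds_word (c.2 ord_max) (lift_word v).

End Run.

Definition polytime (Sigma : finType) (f : seq Sigma -> seq Sigma) : Prop :=
  exists (X : machine Sigma) (b : {poly nat}),
    forall w, halts_with X b.[size w]%R w (f w).

Definition poly_reducible (Sigma : finType) (A B : set (seq Sigma)) : Prop :=
  exists2 f : seq Sigma -> seq Sigma, polytime f & forall w, A w <-> B (f w).

Notation "A <=pm B" := (poly_reducible A B) (at level 70).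

(* Main.v *)
(** On a team with at most one world every dependence atom holds, and by
    downward closure satisfiability is witnessed by such a team. Diamonds can
    be served by one successor, so without boxes the teams never grow; without
    diamonds one may delete all edges, because every formula holds in the empty
    team. Hence dep(...) may be replaced by ⊤, and its negation by ⊥.
    Well-formedness of dependence atoms is a regular condition, so this
    replacement is computed by a finite transducer, which also rejects the
    words using operators outside M; it rejects by emitting a semicolon, a
    symbol that no formula without dependence atoms contains. *)
Require Import Defs.
From HB Require Import structures.
From mathcomp Require Import all_boot all_algebra.
From mathcomp Require Import boolp classical_sets.

Local Open Scope classical_set_scope.

Fixpoint undep (phi : formula) : formula :=
  match phi with
  | Dep _ _ => Top
  | NegDep _ _ => Bot
  | And phi psi => And (undep phi) (undep psi)
  | Or phi psi => Or (undep phi) (undep psi)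
  | COr phi psi => COr (undep phi) (undep psi)
  | Box phi => Box (undep phi)
  | Diamond phi => Diamond (undep phi)
  | _ => phi
  end.

(** * Satisfaction in small teams *)

(** Negation is confined to atoms, where it asks nothing of an empty team. This makes boxes harmless
    once they lead to the empty team. *)
Lemma sat_set0 (W : frame) (phi : formula) : sat (W := W) set0 phi.
Proof.
elim: phi => //=.
- by move=> phi IHphi psi IHpsi; exists set0, set0; split; rewrite ?setU0.
- by move=> phi IHphi psi IHpsi; left.
- move=> phi IHphi; suff -> : [set s' | exists2 s, set0 s & rel_of s s'] =
    set0 :> set W by [].
  by apply/seteqP; split=> s' // [].
- by move=> phi IHphi; exists set0.
Qed.

(** For [Or] the splitting is intersected with the smaller team; for [Box] the successor team
    shrinks with the team; for [Diamond] the same witness serves. *)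
Lemma sat_downward (W : frame) (phi : formula) (T U : set W) :
  U `<=` T -> sat T phi -> sat U phi.
Proof.
elim: phi T U => /=.
- by [].
- by move=> T U UT T0; apply/seteqP; split=> // s /UT; rewrite T0.
- by move=> p T U UT Tp s /UT /Tp.
- by move=> p T U UT Tp s /UT /Tp.
- by move=> ps q T U UT Tq s1 s2 /UT Ts1 /UT Ts2; apply: Tq.
- by move=> _ _ T U UT T0; apply/seteqP; split=> // s /UT; rewrite T0.
- by move=> phi IHphi psi IHpsi T U UT [/(IHphi _ _ UT) ? /(IHpsi _ _ UT)].
- move=> phi IHphi psi IHpsi T U UT [T1 [T2 [eT phiT1 psiT2]]].
  exists (U `&` T1), (U `&` T2); split.
  + by rewrite -setIUr -eT; apply/esym/setIidPl.
  + exact: IHphi (@subIsetr _ _ _) phiT1.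
  + exact: IHpsi (@subIsetr _ _ _) psiT2.
- move=> phi IHphi psi IHpsi T U UT.
  by move=> [/(IHphi _ _ UT)|/(IHpsi _ _ UT)]; [left|right].
- move=> phi IHphi T U UT; apply: IHphi => s' [s Us ss'].
  by exists s => //; apply: UT.
- move=> phi IHphi T U UT [T' phiT' TT']; exists T' => // s /UT.
  exact: TT'.
Qed.

Definition subsingleton (A : Type) (T : set A) : Prop :=
  forall s t, T s -> T t -> s = t.

Lemma sat_diamond_subsingleton (W : frame) (T : set W) (phi : formula) :
  subsingleton W T -> sat T (Diamond phi) ->
  exists2 T' : set W, subsingleton W T' & sat T' phi /\
    forall s, T s -> exists2 s', T' s' & rel_of s s'.
Proof.
move=> T1 [T' phiT' TT']; have [T0|/set0P[s Ts]] := eqVneq T set0.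
  by exists set0 => //; split; [exact: sat_set0|rewrite T0].
have [s' T's' ss'] := TT' _ Ts; exists [set s'] => [u v -> ->//|]; split.
  by apply: sat_downward phiT' => _ ->.
by move=> t /(T1 _ _ Ts) <-; exists s'.
Qed.

(** The second hypothesis keeps every team met in the induction subsingleton: only [Box] could lead
    from one world to several, so it is absent or leads to the empty team. *)
Lemma sat_undep (W : frame) (T : set W) (phi : formula) :
  subsingleton W T ->
  ~ operators phi OBox \/ (forall s s' : W, ~ rel_of s s') ->
  sat T phi <-> sat T (undep phi).
Proof.
elim: phi T => //=.
- by move=> ps q T T1 _; split=> // _ s1 s2 Ts1 /(T1 _ _ Ts1) ->.
- move=> phi IHphi psi IHpsi T T1 H.
  have H1 : ~ operators phi OBox \/ (forall s s' : W, ~ rel_of s s').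
    by case: H => [H|]; [left => ?; apply: H; right; left|right].
  have H2 : ~ operators psi OBox \/ (forall s s' : W, ~ rel_of s s').
    by case: H => [H|]; [left => ?; apply: H; right; right|right].
  by rewrite (IHphi _ T1 H1) (IHpsi _ T1 H2).
- move=> phi IHphi psi IHpsi T T1 H.
  have H1 : ~ operators phi OBox \/ (forall s s' : W, ~ rel_of s s').
    by case: H => [H|]; [left => ?; apply: H; right; left|right].
  have H2 : ~ operators psi OBox \/ (forall s s' : W, ~ rel_of s s').
    by case: H => [H|]; [left => ?; apply: H; right; right|right].
  split=> -[U [V [eT phiU psiV]]]; exists U, V; split=> //.
  + by apply/(IHphi U) => // s t Us Ut; apply: T1; rewrite eT; left.
  + by apply/(IHpsi V) => // s t Vs Vt; apply: T1; rewrite eT; right.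
  + by apply/(IHphi U) => // s t Us Ut; apply: T1; rewrite eT; left.
  + by apply/(IHpsi V) => // s t Vs Vt; apply: T1; rewrite eT; right.
- move=> phi IHphi psi IHpsi T T1 H.
  have H1 : ~ operators phi OBox \/ (forall s s' : W, ~ rel_of s s').
    by case: H => [H|]; [left => ?; apply: H; right; left|right].
  have H2 : ~ operators psi OBox \/ (forall s s' : W, ~ rel_of s s').
    by case: H => [H|]; [left => ?; apply: H; right; right|right].
  by rewrite (IHphi _ T1 H1) (IHpsi _ T1 H2).
- move=> phi IHphi T T1 [[]|R0]; first by left.
  by apply: IHphi; [move=> s t [u _ /R0]|right].
- move=> phi IHphi T T1 H.
  have H1 : ~ operators phi OBox \/ (forall s s' : W, ~ rel_of s s').
    by case: H => [H|]; [left => ?; apply: H; right|right].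
  split=> /(sat_diamond_subsingleton _ _ _ T1) [T' T'1 [phiT' TT']].
  + by exists T' => //; apply/IHphi.
  + by exists T' => //; apply/IHphi.
Qed.

Definition edgeless (W : frame) : frame :=
  Frame (world_nonempty W) (fun _ _ => False) (@val_of W).

(** Without diamonds only [Box] notices the deletion, and it then speaks about the empty team, which
    satisfies every formula. *)
Lemma sat_edgeless (W : frame) (T : set W) (phi : formula) :
  ~ operators phi ODiamond -> sat T phi -> sat (W := edgeless W) T phi.
Proof.
elim: phi T => //=.
- move=> phi IHphi psi IHpsi T H [phiT psiT].
  split; [apply: IHphi => // ?|apply: IHpsi => // ?]; apply: H; right.
  + by left.
  + by right.
- move=> phi IHphi psi IHpsi T H [U [V [eT phiU psiV]]].
  exists U, V; split=> //; [apply: IHphi => // ?|apply: IHpsi => // ?].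
  + by apply: H; right; left.
  + by apply: H; right; right.
- move=> phi IHphi psi IHpsi T H [phiT|psiT]; [left|right].
  + by apply: IHphi => // ?; apply: H; right; left.
  + by apply: IHpsi => // ?; apply: H; right; right.
- move=> phi _ T _ _; apply: (sat_downward (edgeless W) _ set0) => [s' []//|].
  exact: sat_set0.
- by move=> phi _ T []; left.
Qed.

Lemma singleton_model (phi : formula) :
  ~ operators phi OBox \/ ~ operators phi ODiamond -> satisfiable phi ->
  exists (W : frame) (s : W), sat [set s] phi /\
    (~ operators phi OBox \/ (forall s s' : W, ~ rel_of s s')).
Proof.
move=> H [W [T [[s Ts] phiT]]].
have phis : sat [set s] phi by apply: sat_downward phiT => _ ->.
case: H => H; first by exists W, s; split; [|left].
by exists (edgeless W), s; split; [exact: sat_edgeless|right=> ? ?; apply].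
Qed.

Lemma operators_undep_modal (phi : formula) (o : operator) :
  o = OBox \/ o = ODiamond -> operators (undep phi) o <-> operators phi o.
Proof.
move=> Ho; elim: phi => //=.
- by move=> _ _; case: Ho => ->.
- by move=> _ _; split; case: Ho => -> //= [].
- by move=> phi IHphi psi IHpsi; rewrite /setU /= IHphi IHpsi.
- by move=> phi IHphi psi IHpsi; rewrite /setU /= IHphi IHpsi.
- by move=> phi IHphi psi IHpsi; rewrite /setU /= IHphi IHpsi.
- by move=> phi IHphi; rewrite /setU /= IHphi.
- by move=> phi IHphi; rewrite /setU /= IHphi.
Qed.

Lemma MDL_undep (M : set operator) (phi : formula) :
  MDL (M `|` [set ODep]) phi -> MDL (M `|` [set OTop; OBot]) (undep phi).
Proof.
have keep o : o <> ODep -> (M `|` [set ODep]) o -> (M `|` [set OTop; OBot]) o.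
  by move=> ne [Mo|//]; left.
rewrite /MDL /=; elim: phi => //=.
- by move=> H o ->; right; left.
- by move=> H o ->; right; right.
- by move=> p H o [].
- by move=> p H o ->; apply: keep => //; apply: H.
- by move=> ps q H o ->; right; left.
- by move=> ps q H o ->; right; right.
- move=> phi IHphi psi IHpsi H o [->|[|]].
  + by apply: keep => //; apply: H; left.
  + by apply: IHphi => // ? ?; apply: H; right; left.
  + by apply: IHpsi => // ? ?; apply: H; right; right.
- move=> phi IHphi psi IHpsi H o [->|[|]].
  + by apply: keep => //; apply: H; left.
  + by apply: IHphi => // ? ?; apply: H; right; left.
  + by apply: IHpsi => // ? ?; apply: H; right; right.
- move=> phi IHphi psi IHpsi H o [->|[|]].
  + by apply: keep => //; apply: H; left.
  + by apply: IHphi => // ? ?; apply: H; right; left.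
  + by apply: IHpsi => // ? ?; apply: H; right; right.
- move=> phi IHphi H o [->|]; first by apply: keep => //; apply: H; left.
  by apply: IHphi => // ? ?; apply: H; right.
- move=> phi IHphi H o [->|]; first by apply: keep => //; apply: H; left.
  by apply: IHphi => // ? ?; apply: H; right.
Qed.

Lemma satisfiable_undep (phi : formula) :
  ~ operators phi OBox \/ ~ operators phi ODiamond ->
  satisfiable phi <-> satisfiable (undep phi).
Proof.
have Box_undep := operators_undep_modal phi OBox (or_introl erefl).
have Diamond_undep := operators_undep_modal phi ODiamond (or_intror erefl).
have set1_sub (W : frame) (s : W) : subsingleton W [set s] by move=> ? ? -> ->.
move=> H; split.
- move=> /(singleton_model _ H) [W [s [phis HW]]]; exists W, [set s].
  by split; [exists s|apply/(sat_undep W _ phi (set1_sub W s) HW)].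
(* [undep] changes no modal operator, so [undep phi] has a one-world model too; in the same frame
   this is a model of [phi]. *)
- move: (H); rewrite -{1}Box_undep -Diamond_undep => /singleton_model H'.
  move=> /H' [W [s [phis HW]]]; exists W, [set s]; split; first by exists s.
  by apply/sat_undep => //; rewrite -Box_undep.
Qed.

(** * Transducers run in linear time *)

Section Transducer.

Variables (Sigma Q : finType) (q0 : Q).
Variable delta : Q -> Sigma -> option Sigma -> Q * option Sigma.
Variable fin : Q -> option Sigma.

(* The last argument of [delta] is the symbol after the current one, if any. *)
Fixpoint transduce (q : Q) (w : seq Sigma) : seq Sigma :=
  match w with
  | [::] => seq_of_opt (fin q)
  | a :: w' => let: (q', o) := delta q a (ohead w') in
      seq_of_opt o ++ transduce q' w'
  end.

Notation cell := (option (Sigma + void)).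

(** The output head always stands on the blank cell after the output, so with nothing to emit a
    blank is rewritten in place. *)
Definition emit (o : option Sigma) : cell * move :=
  (omap inl o, if o is Some _ then MoveRight else Stay).

Definition read (c : cell) : option Sigma :=
  if c is Some (inl a) then Some a else None.

(* State [Some (q, Some a)]: the symbol a, left of the head, is to be processed
   in state q once its successor has been read. [None] is the halting state. *)
Definition transducer_next (st : option (Q * option Sigma))
    (cs : {ffun 'I_2 -> cell}) :
    option (Q * option Sigma) * {ffun 'I_2 -> cell * move} :=
  let next := read (cs ord0) in
  let: (st', o) :=
    match st with
    | Some (q, Some a) =>
        let: (q', o) := delta q a next in (Some (q', next), o)
    | Some (q, None) =>
        if next is Some _ then (Some (q, next), None) else (None, fin q)
    | None => (None, None)
    end in
  (st', [ffun i => if i == ord0 then (cs i, MoveRight) else emit o]).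

Definition transducer : machine Sigma :=
  Machine (Some (q0, None)) (fun st => st == None) transducer_next.

Let cells (w : seq Sigma) : seq cell := map Some (map inl w).

(** [w] is the unread input and [s] the output so far. The cells [l] behind the input head are never
    revisited, so the run lemmas leave them existential. *)
Let tapes (l : seq cell) (w s : seq Sigma) (i : 'I_2) : tape (Sigma + void) :=
  if i == ord0 then Tape l (head None (cells w)) (behead (cells w))
  else Tape (rev (cells s)) None [::].

Lemma step_transducer (st st' : option (Q * option Sigma)) (o : option Sigma)
    (l : seq cell) (w s : seq Sigma) :
  st != None ->
  (forall cs : {ffun 'I_2 -> cell}, read (cs ord0) = ohead w ->
    transducer_next st cs =
    (st', [ffun i => if i == ord0 then (cs i, MoveRight) else emit o])) ->
  exists l', step (X := transducer) (st, tapes l w s) =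
             (st', tapes l' (behead w) (s ++ seq_of_opt o)).
Proof.
move=> st0 next; exists (head None (cells w) :: l).
rewrite /step [tm_halt _]/= (negbTE st0) [tm_next _ _]/= next; last first.
  by rewrite ffunE /tapes eqxx; case: (w).
congr pair; apply/funext => i; rewrite !ffunE /tapes.
case: eqVneq => _ /=; first by case: w {next}.
by case: o {next} => [a|] /=; rewrite ?cats0 // /cells !map_cat rev_cat.
Qed.

(** The head is one cell ahead of the symbol being processed: one step for [a], one for each symbol
    of [w], and a last one for [fin]. *)
Lemma transducer_run (q : Q) (a : Sigma) (l : seq cell) (w s : seq Sigma) :
  exists l', iter (size w).+2 (step (X := transducer))
               (Some (q, Some a), tapes l w s) =
             (None, tapes l' [::] (s ++ transduce q (a :: w))).
Proof.
elim: w => [|b w IHw] in q a l s *; rewrite [transduce _ _]/=.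
- case E: (delta q a None) => [q' o].
  have [|cs cs0|l1 e1] := step_transducer
    (Some (q, Some a)) (Some (q', None)) o l [::] s => //.
    by rewrite /transducer_next cs0 E.
  have [|cs cs0|l2 e2] := step_transducer
    (Some (q', None)) None (fin q') l1 [::] (s ++ seq_of_opt o) => //.
    by rewrite /transducer_next cs0.
  by exists l2; rewrite catA -e2 -e1.
- case E: (delta q a (Some b)) => [q' o].
  have [|cs cs0|l1 e1] := step_transducer
    (Some (q, Some a)) (Some (q', Some b)) o l (b :: w) s => //.
    by rewrite /transducer_next cs0 E.
  have [l2 e2] := IHw q' b l1 (s ++ seq_of_opt o).
  by exists l2; rewrite iterSr e1 e2 -catA.
Qed.

Lemma transducer_halts (w : seq Sigma) :
  exists l, iter (size w).+2 (step (X := transducer)) (initial transducer w) =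
            (None, tapes l [::] (transduce q0 w)).
Proof.
have -> : initial transducer w = (Some (q0, None), tapes [::] w [::]) by [].
case: w => [|a w].
- have [|cs cs0|l e] :=
    step_transducer (Some (q0, None)) None (fin q0) [::] [::] [::] => //.
    by rewrite /transducer_next cs0.
  (* On the empty word one step suffices; the second leaves the halted configuration unchanged. *)
  by exists l; apply: (congr1 (step (X := transducer)) e).
- have [|cs cs0|l1 e1] := step_transducer
    (Some (q0, None)) (Some (q0, Some a)) None [::] (a :: w) [::] => //.
    by rewrite /transducer_next cs0.
  have [l2 e2] := transducer_run q0 a l1 w [::].
  by exists l2; rewrite [size _]/= iterSr e1 e2.
Qed.

Lemma polytime_transduce : polytime (transduce q0).
Proof.
exists transducer, ('X + 2%:P)%R => w.
have -> : ('X + 2%:P : {poly nat}).[size w]%R = (size w).+2.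
  by rewrite hornerD hornerX hornerC -[LHS]/(size w + 2)%N addn2.
rewrite /halts_with; have [l ->] := transducer_halts w; split=> //.
(* The single blank after the output is the cell under the head. *)
exists 0%N, 1%N.
by rewrite /tape_cells /tapes /= revK.
Qed.

End Transducer.

(** * The transducer replacing dependence atoms *)

(** Positions relative to a dependence atom. A bit is admissible in [PremiseBits] but not in
    [Premises], where no [SAtom] has been read yet; likewise for the conclusion. *)
Inductive mode : Type :=
| Plain | NegatedDep | Premises | PremiseBits | Conclusion | ConclusionBits.

Definition modes : seq mode :=
  [:: Plain; NegatedDep; Premises; PremiseBits; Conclusion; ConclusionBits].

Definition mode_code (q : mode) : nat :=
  match q with
  | Plain => 0 | NegatedDep => 1 | Premises => 2 | PremiseBits => 3
  | Conclusion => 4 | ConclusionBits => 5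
  end.

Lemma mode_codeK : pcancel mode_code (onth modes).
Proof. by case. Qed.

HB.instance Definition _ := Countable.copy mode (pcan_type mode_codeK).

Lemma modes_enumP : Finite.axiom modes.
Proof. by case. Qed.

HB.instance Definition _ := isFinite.Build mode modes_enumP.

Section Undep.

Variable N : set operator.

(** [N] is fixed and not part of the input, so these truth values are finitely many constants of the
    transition table. Legitimate semicolons occur only inside dependence atoms and are consumed in
    other modes. *)
Definition allowed (a : symbol) : bool :=
  match a with
  | SBox => `[< N OBox >] | SDiamond => `[< N ODiamond >]
  | SAnd => `[< N OAnd >] | SOr => `[< N OOr >] | SNeg => `[< N ONeg >]
  | STop => `[< N OTop >] | SBot => `[< N OBot >] | SDep => `[< N ODep >]
  | SCOr => `[< N OCOr >] | SSemi => false | SAtom | SBit _ => true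
  end.

(** The lookahead tells a negated dependence atom from a negated proposition before anything is
    emitted for the negation sign. *)
Definition plain_step (a : symbol) (next : option symbol) :
    mode * option symbol :=
  if ~~ allowed a then (Plain, Some SSemi) else
  match a, next with
  | SDep, _ => (Premises, Some STop)
  | SNeg, Some SDep => (NegatedDep, Some SBot)
  | _, _ => (Plain, Some a)
  end.

(** Names carry no end marker: [ConclusionBits] ends at the first symbol other than a bit, which is
    then treated as in [Plain]. In [NegatedDep] the replacement [SBot] is already written. *)
Definition undep_step (q : mode) (a : symbol) (next : option symbol) :
    mode * option symbol :=
  match q, a with
  | NegatedDep, SDep =>
      if allowed SDep then (Premises, None) else (Plain, Some SSemi)
  | (Premises | PremiseBits), SAtom | PremiseBits, SBit _ =>
      (PremiseBits, None)
  | (Premises | PremiseBits), SSemi => (Conclusion, None)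
  | Conclusion, SAtom | ConclusionBits, SBit _ => (ConclusionBits, None)
  | (Plain | ConclusionBits), _ => plain_step a next
  | _, _ => (Plain, Some SSemi)
  end.

(** Outside these two modes the word breaks off inside an unfinished dependence atom. *)
Definition undep_final (q : mode) : option symbol :=
  if q is (Plain | ConclusionBits) then None else Some SSemi.

Notation undep_word := (transduce symbol mode undep_step undep_final).

(** Bits following a dependence atom would be swallowed as part of the name of its conclusion; this
    predicate serves to exclude that. *)
Definition starts_with_bit (w : seq symbol) : bool :=
  if w is SBit _ :: _ then true else false.

Lemma encode_starts_with_bit (phi : formula) (w : seq symbol) :
  starts_with_bit (encode phi ++ w) = false.
Proof. by case: phi. Qed.

Lemma undep_word_bits (p : AP) (w : seq symbol) :
  undep_word Plain (map SBit p ++ w) = map SBit p ++ undep_word Plain w.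
Proof. by elim: p => //= b p ->. Qed.

Lemma undep_word_ConclusionBits (w : seq symbol) :
  ~~ starts_with_bit w -> undep_word ConclusionBits w = undep_word Plain w.
Proof. by case: w => [|[]]. Qed.

Lemma undep_word_dep (ps : seq AP) (q : AP) (w : seq symbol) :
  ~~ starts_with_bit w ->
  undep_word Premises
    (flatten (map encode_atom ps) ++ SSemi :: encode_atom q ++ w) =
  undep_word Plain w.
Proof.
move=> nbw; set u := SSemi :: _.
have eu m : m = Premises \/ m = PremiseBits ->
    undep_word m u = undep_word Plain w.
  suff e : undep_word ConclusionBits (map SBit q ++ w) = undep_word Plain w.
    by case=> -> /=.
  by elim: q {u} => //=; exact: undep_word_ConclusionBits.
(* After the first premise the mode is [PremiseBits], so the induction on the premises covers both
   modes. *)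
suff H m : m = Premises \/ m = PremiseBits ->
    undep_word m (flatten (map encode_atom ps) ++ u) = undep_word Plain w.
  by apply: H; left.
elim: ps m => [|p ps IHps] m Hm; first exact: eu.
rewrite -[flatten _]/(encode_atom p ++ flatten (map encode_atom ps)) -catA.
have -> : forall v, undep_word m (encode_atom p ++ v) =
                    undep_word PremiseBits (map SBit p ++ v).
  by move=> v; case: Hm => ->.
by elim: p => [|b p //]; apply: IHps; right.
Qed.

(** The suffix [w] is needed for the induction: in prefix notation the encoding of the second
    subformula follows that of the first. *)
Lemma undep_word_encode (phi : formula) (w : seq symbol) :
  MDL N phi -> ~~ starts_with_bit w ->
  undep_word Plain (encode phi ++ w) =
  encode (undep phi) ++ undep_word Plain w.
Proof.
rewrite /MDL /=; elim: phi w => /=.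
- by move=> w /(_ _ erefl) NT _; rewrite /plain_step /= (asboolT NT).
- by move=> w /(_ _ erefl) NB _; rewrite /plain_step /= (asboolT NB).
- by move=> p w _ _; rewrite undep_word_bits.
- move=> p w /(_ _ erefl) NN _.
  by rewrite /plain_step /= (asboolT NN) /= undep_word_bits.
- move=> ps q w /(_ _ erefl) ND nbw.
  by rewrite /plain_step /= (asboolT ND) /= -catA undep_word_dep.
- move=> ps q w NND nbw.
  have NN := NND _ (or_introl erefl); have ND := NND _ (or_intror erefl).
  rewrite /plain_step /= (asboolT NN) /= (asboolT ND) /= -catA.
  by rewrite undep_word_dep.
- move=> phi IHphi psi IHpsi w H nbw; have NA := H _ (or_introl erefl).
  rewrite /plain_step /= (asboolT NA) /= -!catA IHphi ?IHpsi //.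
  + by move=> o ?; apply: H; right; right.
  + by move=> o ?; apply: H; right; left.
  + by rewrite encode_starts_with_bit.
- move=> phi IHphi psi IHpsi w H nbw; have NA := H _ (or_introl erefl).
  rewrite /plain_step /= (asboolT NA) /= -!catA IHphi ?IHpsi //.
  + by move=> o ?; apply: H; right; right.
  + by move=> o ?; apply: H; right; left.
  + by rewrite encode_starts_with_bit.
- move=> phi IHphi psi IHpsi w H nbw; have NA := H _ (or_introl erefl).
  rewrite /plain_step /= (asboolT NA) /= -!catA IHphi ?IHpsi //.
  + by move=> o ?; apply: H; right; right.
  + by move=> o ?; apply: H; right; left.
  + by rewrite encode_starts_with_bit.
- move=> phi IHphi w H nbw; have NA := H _ (or_introl erefl).
  by rewrite /plain_step /= (asboolT NA) /= IHphi // => o ?; apply: H; right.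
- move=> phi IHphi w H nbw; have NA := H _ (or_introl erefl).
  by rewrite /plain_step /= (asboolT NA) /= IHphi // => o ?; apply: H; right.
Qed.

(** * Recovering the input from an output without semicolons *)

Lemma undep_word_ConclusionBits_inv (w : seq symbol) :
  exists (q : AP) (w' : seq symbol),
    w = map SBit q ++ w' /\ undep_word ConclusionBits w = undep_word Plain w'.
Proof.
elim: w => [|a w [q [w' [ew e]]]]; first by exists [::], [::].
case: (boolP (starts_with_bit (a :: w))) => [|nb].
  by case: a => // b _; exists (b :: q), w'; rewrite /= e ew.
by exists [::], (a :: w); rewrite undep_word_ConclusionBits.
Qed.

(** Every departure from the shape of a dependence atom, including a premature end, emits a
    semicolon. *)
Lemma undep_word_Premises_inv (w : seq symbol) :
  SSemi \notin undep_word Premises w ->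
  exists (ps : seq AP) (q : AP) (w' : seq symbol),
    w = flatten (map encode_atom ps) ++ SSemi :: encode_atom q ++ w' /\
    undep_word Premises w = undep_word Plain w'.
Proof.
(* Reading a premise leads to [PremiseBits], so a companion statement is proved along with it, in
   which [p] is the rest of the current name. *)
suff [H _] : (SSemi \notin undep_word Premises w ->
  exists (ps : seq AP) (q : AP) (w' : seq symbol),
    w = flatten (map encode_atom ps) ++ SSemi :: encode_atom q ++ w' /\
    undep_word Premises w = undep_word Plain w') /\
  (SSemi \notin undep_word PremiseBits w ->
  exists (p : AP) (ps : seq AP) (q : AP) (w' : seq symbol),
    w = map SBit p ++ flatten (map encode_atom ps) ++
        SSemi :: encode_atom q ++ w' /\
    undep_word PremiseBits w = undep_word Plain w') by [].
elim: w => [|a w [IHw IHb]]; first by split.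
have semi : SSemi \notin undep_word Conclusion w ->
    exists (q : AP) (w' : seq symbol),
    w = encode_atom q ++ w' /\ undep_word Conclusion w = undep_word Plain w'.
  case: w {IHw IHb} => [//|[] //= w _].
  have [q [w' [-> ->]]] := undep_word_ConclusionBits_inv w.
  by exists q, w'.
split; [case: a => //= [|] H|case: a => //= [||b] H].
- have [p [ps [q [w' [-> ->]]]]] := IHb H.
  by exists (p :: ps), q, w'; rewrite /= -catA.
- have [q [w' [-> ->]]] := semi H.
  by exists [::], q, w'.
- have [p [ps [q [w' [-> ->]]]]] := IHb H.
  by exists [::], (p :: ps), q, w'; rewrite /= -catA.
- have [q [w' [-> ->]]] := semi H.
  by exists [::], [::], q, w'.
- have [p [ps [q [w' [-> ->]]]]] := IHb H.
  by exists (b :: p), ps, q, w'.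
Qed.

(** In [Plain] every input symbol emits at once, so the first output symbol stems from the first
    input symbol: a copy, or the replacement of a plain or negated dependence atom. Rejection would
    leave a semicolon. *)
Lemma undep_word_cons_inv (w u : seq symbol) (a : symbol) :
  undep_word Plain w = a :: u -> SSemi \notin a :: u ->
  exists w', [\/ [/\ w = a :: w', allowed a & undep_word Plain w' = u],
    [/\ a = STop, w = SDep :: w', N ODep & undep_word Premises w' = u] |
    [/\ a = SBot, w = SNeg :: SDep :: w', N ONeg, N ODep &
        undep_word Premises w' = u]].
Proof.
case: w => [//|b w] /=; rewrite /plain_step.
case: ifP => [_ [<- _] //|/negbFE allowed_b].
case: b allowed_b => /=; do ?by move=> ? [<- <-] _; exists w; apply: Or31.
(* The negation sign is copied unless [SDep] follows. *)
- case: w => [|c w]; first by move=> ? [<- <-] _; exists [::]; apply: Or31.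
  case: c => [|||||||||||b];
    do ?by move=> ? [<- <-] _; eexists; apply: Or31; split.
  rewrite /= => /asboolP NN; case: asboolP => ND [<- <-] //= _.
  by exists w; apply: Or33.
- by move=> /asboolP ND [<- <-] _; exists w; apply: Or32.
- by move=> b _ [<- <-] _; exists w; apply: Or31.
Qed.

Lemma undep_word_bits_inv (p : AP) (w v : seq symbol) :
  undep_word Plain w = map SBit p ++ v -> SSemi \notin v ->
  exists w', w = map SBit p ++ w' /\ undep_word Plain w' = v.
Proof.
elim: p w => [|b p IHp] w /= e nv; first by exists w.
have nbv : SSemi \notin map SBit p ++ v.
  by rewrite mem_cat negb_or nv andbT; elim: (p).
have [w1 [] [] // ew _ /IHp [//|w' [ew' ev]]] :=
  undep_word_cons_inv _ _ _ e nbv.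
by exists w'; rewrite ew ew'.
Qed.

Lemma SSemi_notin_encode (psi : formula) :
  ~ operators psi ODep -> SSemi \notin encode psi.
Proof.
have bits p : SSemi \notin map SBit p by elim: p.
elim: psi => //=.
- by move=> p _; rewrite inE bits.
- by move=> p _; rewrite !inE bits.
- by move=> ps q []; right.
- move=> phi IHphi psi IHpsi H; rewrite inE mem_cat !negb_or /=.
  rewrite IHphi ?IHpsi // => ?; apply: H; right.
  + by right.
  + by left.
- move=> phi IHphi psi IHpsi H; rewrite inE mem_cat !negb_or /=.
  rewrite IHphi ?IHpsi // => ?; apply: H; right.
  + by right.
  + by left.
- move=> phi IHphi psi IHpsi H; rewrite inE mem_cat !negb_or /=.
  rewrite IHphi ?IHpsi // => ?; apply: H; right.
  + by right.
  + by left.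
- by move=> phi IHphi H; rewrite inE IHphi // => ?; apply: H; right.
- by move=> phi IHphi H; rewrite inE IHphi // => ?; apply: H; right.
Qed.

(** [undep] is not injective, so a preimage is rebuilt symbol by symbol: [STop] and [SBot] may each
    be a copy or stand for an atom, everything else is a copy. Membership in [MDL N] comes from the
    [allowed] tests passed on the way. *)
Lemma undep_word_encode_inv (psi : formula) (w v : seq symbol) :
  ~ operators psi ODep -> SSemi \notin v ->
  undep_word Plain w = encode psi ++ v ->
  exists (phi : formula) (w' : seq symbol),
    [/\ w = encode phi ++ w', undep phi = psi, MDL N phi &
        undep_word Plain w' = v].
Proof.
elim: psi w v.
- move=> w v _ nv e; have [w1 []] := undep_word_cons_inv _ _ _ e nv.
  + by move=> [-> /asboolP NT ev]; exists Top, w1; split=> // _ ->.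
  + move=> [_ -> ND ev].
    have [|ps [q [w' [ew ew']]]] := undep_word_Premises_inv w1.
      by rewrite ev.
    exists (Dep ps q), w'; split; rewrite -?ew' //.
      by rewrite ew /= -catA.
    by move=> _ ->.
  + by case.
- move=> w v _ nv e; have [w1 []] := undep_word_cons_inv _ _ _ e nv.
  + by move=> [-> /asboolP NB ev]; exists Bot, w1; split=> // _ ->.
  + by case.
  + move=> [_ -> NN ND ev].
    have [|ps [q [w' [ew ew']]]] := undep_word_Premises_inv w1.
      by rewrite ev.
    exists (NegDep ps q), w'; split; rewrite -?ew' //.
      by rewrite ew /= -catA.
    by move=> _ [->|->].
- move=> p w v _ nv e.
  have nv' : SSemi \notin map SBit p ++ v.
    by rewrite mem_cat negb_or nv andbT; elim: (p).
  have [w1 [] [] // -> _ e1] := undep_word_cons_inv _ _ _ e nv'.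
  have [w' [-> ev]] := undep_word_bits_inv _ _ _ e1 nv.
  by exists (Atom p), w'; split=> // _ [].
- move=> p w v _ nv e.
  have nv' : SSemi \notin map SBit p ++ v.
    by rewrite mem_cat negb_or nv andbT; elim: (p).
  have [w1 [] [] // -> /asboolP NN e1] := undep_word_cons_inv _ _ _ e nv'.
  have [w2 [] [] // -> _ e2] := undep_word_cons_inv _ _ _ e1 nv'.
  have [w' [-> ev]] := undep_word_bits_inv _ _ _ e2 nv.
  by exists (NegAtom p), w'; split=> // _ ->.
- by move=> ps q w v [].
- by move=> ps q w v []; right.
- move=> phi IHphi psi IHpsi w v H nv.
  have nphi : ~ operators phi ODep by move=> ?; apply: H; right; left.
  have npsi : ~ operators psi ODep by move=> ?; apply: H; right; right.
  rewrite /= -catA => e.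
  have nv' : SSemi \notin encode psi ++ v.
    by rewrite mem_cat negb_or SSemi_notin_encode.
  have nv'' : SSemi \notin encode phi ++ encode psi ++ v.
    by rewrite mem_cat negb_or SSemi_notin_encode.
  have [w1 [] [] // -> /asboolP NC e1] := undep_word_cons_inv _ _ _ e nv''.
  have [phi' [w2 [-> <- Nphi' e2]]] := IHphi _ _ nphi nv' e1.
  have [psi' [w3 [-> <- Npsi' e3]]] := IHpsi _ _ npsi nv e2.
  exists (And phi' psi'), w3; split=> //; first by rewrite /= -catA.
  by move=> o [->|[/Nphi'|/Npsi']].
- move=> phi IHphi psi IHpsi w v H nv.
  have nphi : ~ operators phi ODep by move=> ?; apply: H; right; left.
  have npsi : ~ operators psi ODep by move=> ?; apply: H; right; right.
  rewrite /= -catA => e.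
  have nv' : SSemi \notin encode psi ++ v.
    by rewrite mem_cat negb_or SSemi_notin_encode.
  have nv'' : SSemi \notin encode phi ++ encode psi ++ v.
    by rewrite mem_cat negb_or SSemi_notin_encode.
  have [w1 [] [] // -> /asboolP NC e1] := undep_word_cons_inv _ _ _ e nv''.
  have [phi' [w2 [-> <- Nphi' e2]]] := IHphi _ _ nphi nv' e1.
  have [psi' [w3 [-> <- Npsi' e3]]] := IHpsi _ _ npsi nv e2.
  exists (Or phi' psi'), w3; split=> //; first by rewrite /= -catA.
  by move=> o [->|[/Nphi'|/Npsi']].
- move=> phi IHphi psi IHpsi w v H nv.
  have nphi : ~ operators phi ODep by move=> ?; apply: H; right; left.
  have npsi : ~ operators psi ODep by move=> ?; apply: H; right; right.
  rewrite /= -catA => e.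
  have nv' : SSemi \notin encode psi ++ v.
    by rewrite mem_cat negb_or SSemi_notin_encode.
  have nv'' : SSemi \notin encode phi ++ encode psi ++ v.
    by rewrite mem_cat negb_or SSemi_notin_encode.
  have [w1 [] [] // -> /asboolP NC e1] := undep_word_cons_inv _ _ _ e nv''.
  have [phi' [w2 [-> <- Nphi' e2]]] := IHphi _ _ nphi nv' e1.
  have [psi' [w3 [-> <- Npsi' e3]]] := IHpsi _ _ npsi nv e2.
  exists (COr phi' psi'), w3; split=> //; first by rewrite /= -catA.
  by move=> o [->|[/Nphi'|/Npsi']].
- move=> phi IHphi w v H nv /= e.
  have nphi : ~ operators phi ODep by move=> ?; apply: H; right.
  have nv' : SSemi \notin encode phi ++ v.
    by rewrite mem_cat negb_or SSemi_notin_encode.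
  have [w1 [] [] // -> /asboolP NC e1] := undep_word_cons_inv _ _ _ e nv'.
  have [phi' [w2 [-> <- Nphi' e2]]] := IHphi _ _ nphi nv e1.
  by exists (Box phi'), w2; split=> // o [->|/Nphi'].
- move=> phi IHphi w v H nv /= e.
  have nphi : ~ operators phi ODep by move=> ?; apply: H; right.
  have nv' : SSemi \notin encode phi ++ v.
    by rewrite mem_cat negb_or SSemi_notin_encode.
  have [w1 [] [] // -> /asboolP NC e1] := undep_word_cons_inv _ _ _ e nv'.
  have [phi' [w2 [-> <- Nphi' e2]]] := IHphi _ _ nphi nv e1.
  by exists (Diamond phi'), w2; split=> // o [->|/Nphi'].
Qed.

End Undep.

Theorem theorem6 (M : set operator)
    (HM : M `<=` [set OBox; ODiamond; OAnd; OOr; ONeg; OTop; OBot; OCOr])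
    (Hmod : ~ M OBox \/ ~ M ODiamond) :
  MDL_SAT (M `|` [set ODep]) <=pm MDL_SAT (M `|` [set OTop; OBot]).
Proof.
(* Hence the target formulas contain no dependence atoms, and their encodings no semicolon. *)
have nMdep : ~ M ODep by move=> /HM; do ?[case=> //].
set N := M `|` [set ODep].
exists (transduce symbol mode (undep_step N) undep_final Plain).
  exact: polytime_transduce.
have satE phi : MDL N phi -> satisfiable phi <-> satisfiable (undep phi).
  move=> Nphi; apply: satisfiable_undep.
  by case: Hmod => H; [left|right] => /Nphi [].
move=> w; split=> [[phi [-> Nphi phi_sat]]|[psi [e Mpsi psi_sat]]].
  exists (undep phi); split.
  - rewrite -[encode phi]cats0 undep_word_encode //.
    by rewrite [transduce _ _ _ _ _ _]/= cats0.
  - exact: MDL_undep.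
  - exact/(satE _ Nphi).
have ndep : ~ operators psi ODep by move=> /Mpsi [//|[]].
have [|phi [w' [ew phi_psi Nphi]]] :=
  undep_word_encode_inv N psi w [::] ndep isT; first by rewrite cats0.
(* The remainder [w'] has empty output, while in [Plain] any first symbol would emit something; so
   [w'] is empty. *)
case: w' ew => [|a w'] ew ew'.
  exists phi; split=> //; first by rewrite ew cats0.
  by apply/(satE _ Nphi); rewrite phi_psi.
move: ew' => /=; rewrite /plain_step; case: ifP => // _.
by case: a {ew} w' => // -[|[]].
Qed.
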